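(* Let $n$ be a positive multiple of $3$ and let $P$ be a set of $n$ points in the plane in general position. Suppose that for every integer $k$ with $0\le k<n/3$, the number $E_{\le k}(P)$ of $(\le k)$-edges of $P$ equals exactly $3\binom{k+2}{2}$. Then $P$ is $3$-decomposable.
   Context: For an $n$-point set $P$ in general position and $0\le k\le n/2-1$, a $k$-edge of $P$ is a line through two points of $P$ that leaves exactly $k$ points of $P$ on one of its sides; $E_k(P)$ denotes the number of $k$-edges, and $E_{\le k}(P)=\sum_{j=0}^{k}E_j(P)$ is the number of $(\le k)$-edges. A finite point set $P$ is $3$-decomposable if it can be partitioned into three sets $A,B,C$ of equal size such that there is a triangle $T$ enclosing $P$ for which the orthogonal projection of $P$ onto the three sides of $T$ shows $A$ between $B$ and $C$ on one side, $B$ between $C$ and $A$ on the second side, and $C$ between $A$ and $B$ on the third side. *)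

(* Defs.v *)
From HB Require Import structures.
From mathcomp Require Import all_boot all_order all_algebra.
From mathcomp Require Import reals.
Set Implicit Arguments. Unset Strict Implicit. Unset Printing Implicit Defensive.
Import Order.TTheory GRing.Theory Num.Theory.
Local Open Scope ring_scope.

Section Defs.
Variable R : realType.
Definition pt := (R * R)%type.

(* twice the signed area of triangle abc: > 0 iff c is strictly left of the
   directed line a->b, < 0 iff strictly right, = 0 iff collinear *)
Definition orient (a b c : pt) : R :=
  (b.1 - a.1) * (c.2 - a.2) - (b.2 - a.2) * (c.1 - a.1).

Variable n : nat.
Variable P : 'I_n -> pt.

Definition general_position : Prop :=
  forall i j k : 'I_n, i != j -> j != k -> i != k -> orient (P i) (P j) (P k) != 0.

Definition nleft (a b : pt) : nat := #|[set r : 'I_n | 0 < orient a b (P r)]|.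
Definition nright (a b : pt) : nat := #|[set r : 'I_n | orient a b (P r) < 0]|.

Definition E (k : nat) : nat :=
  #|[set ij : 'I_n * 'I_n | (ij.1 < ij.2)%N &&
      ((nleft (P ij.1) (P ij.2) == k) || (nright (P ij.1) (P ij.2) == k))]|.

Definition E_le (k : nat) : nat := (\sum_(j < k.+1) E j)%N.

(* scalar coordinate of the orthogonal projection of x onto the line of the
   side u -> w, measured along the direction w - u *)
Definition proj_coord (u w x : pt) : R :=
  (x.1 - u.1) * (w.1 - u.1) + (x.2 - u.2) * (w.2 - u.2).

Definition between_on_side (u w : pt) (A B C : {set 'I_n}) : Prop :=
  (forall a b c, a \in A -> b \in B -> c \in C ->
     proj_coord u w (P b) < proj_coord u w (P a) < proj_coord u w (P c)) \/
  (forall a b c, a \in A -> b \in B -> c \in C ->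
     proj_coord u w (P c) < proj_coord u w (P a) < proj_coord u w (P b)).

Definition in_triangle (v0 v1 v2 x : pt) : Prop :=
  (0 < orient v0 v1 v2 /\ 0 < orient v0 v1 x /\ 0 < orient v1 v2 x /\ 0 < orient v2 v0 x) \/
  (orient v0 v1 v2 < 0 /\ orient v0 v1 x < 0 /\ orient v1 v2 x < 0 /\ orient v2 v0 x < 0).

Definition three_decomposable : Prop :=
  exists A B C : {set 'I_n},
    [/\ [disjoint A & B], [disjoint B & C], [disjoint A & C], A :|: B :|: C = setT
      & #|A| = #|B| /\ #|B| = #|C|] /\
    exists v0 v1 v2 : pt,
      (forall i, in_triangle v0 v1 v2 (P i)) /\
      between_on_side v0 v1 A B C /\
      between_on_side v1 v2 B C A /\
      between_on_side v2 v0 C A B.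
End Defs.

(* Main.v *)
Require Import Defs.
From HB Require Import structures.
From mathcomp Require Import all_boot all_order all_algebra.
From mathcomp Require Import reals ring lra zify.
Set Implicit Arguments. Unset Strict Implicit. Unset Printing Implicit Defensive.
Import Order.TTheory GRing.Theory Num.Theory.
Local Open Scope ring_scope.

(** Order the points by their scalar product with a rotating direction d. An
    ordered pair (i, j) with exactly k points to the right of the line from i to
    j is a moment, d = rot (P j - P i), at which i leaves and j enters the set
    of the k+1 lowest points, so (<=k)-edges are counted by these exchanges.

    Let p be a hull vertex and t a direction in which more than k points are
    below p and more than k above. During the half turn from t to -t the k+1
    lowest points are completely replaced, so there are at least k+1 exchanges,
    and p lies strictly on the left of all of them. Removing p then gives
    E_{<=k} >= 3 C(k+2,2) by induction, and equality forces exactly k+1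
    exchanges in that half turn.

    In the extremal case with n = 3(k+1), the hull is a triangle abc, and each
    of its vertices gives such a direction t_a, t_b, t_c; these positively span
    the plane. The three half turns cover the circle and see at most k+1 each of
    the 3(k+1) exchanges, so no exchange happens where two half turns overlap.
    Hence the lowest third in direction t_a is the highest third in direction
    t_c, and cyclically. These three thirds are the required partition, and the
    sides of the triangle can be taken parallel to t_a, t_b, t_c. *)

(** * Plane vectors, perturbed directions and enclosing triangles *)

Section Plane.
Variable R : realType.
Implicit Types d e t u v x : pt R.

Definition dot d x : R := d.1 * x.1 + d.2 * x.2.
Definition cross u v : R := u.1 * v.2 - u.2 * v.1.
Definition opp d : pt R := (- d.1, - d.2).
Definition rot d : pt R := (- d.2, d.1).
Definition sub u v : pt R := (u.1 - v.1, u.2 - v.2).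

Lemma dot_opp d x : dot (opp d) x = - dot d x.
Proof. rewrite /dot /=; ring. Qed.

Lemma dot_sub d x y : dot d (sub x y) = dot d x - dot d y.
Proof. rewrite /dot /=; ring. Qed.

Lemma dot_rot_sub (a b c : pt R) : dot (rot (sub b a)) (sub c a) = orient a b c.
Proof. rewrite /dot /orient /=; ring. Qed.

Lemma dot_rot e t : dot t (rot e) = cross e t.
Proof. rewrite /dot /cross /=; ring. Qed.

(** Multiplicativity of determinants: [dot d0] and [dot d1] are the coordinates of a linear map of
    determinant [cross d0 d1]. *)
Lemma cross_dot d0 d1 (a b c : pt R) :
  cross d0 d1 * orient a b c =
  (dot d0 b - dot d0 a) * (dot d1 c - dot d1 a) -
  (dot d0 c - dot d0 a) * (dot d1 b - dot d1 a).
Proof. rewrite /dot /cross /orient /=; ring. Qed.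

Lemma orientC (a b c : pt R) : orient b a c = - orient a b c.
Proof. rewrite /orient; ring. Qed.

Lemma orient_cycle (a b c : pt R) : orient b c a = orient a b c.
Proof. rewrite /orient; ring. Qed.

Lemma pt_neq0 v : v != (0, 0) -> 0 < v.1 ^+ 2 + v.2 ^+ 2.
Proof.
case: v => x y; rewrite xpair_eqE negb_and /= => H.
rewrite lt_def paddr_eq0 ?sqr_ge0 // !sqrf_eq0 negb_and H /=.
by rewrite addr_ge0 ?sqr_ge0.
Qed.

(** Adding or subtracting [eps] times [w] then flips no sign among the nonzero [dot s v]; finitely
    many [v] leave a positive minimum of admissible scales. *)
Lemma small_scale (s w : pt R) (L : seq (pt R)) :
  exists2 eps : R, 0 < eps &
    forall v, v \in L -> dot s v != 0 -> eps * `|dot w v| < `|dot s v|.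
Proof.
elim: L => [|v L [eps e0 IH]]; first by exists 1.
have [sv0|sv] := eqVneq (dot s v) 0.
  exists eps => // x; rewrite inE => /orP[/eqP->|/IH //].
  by rewrite sv0 eqxx.
have D : 0 < `|dot w v| + 1 by rewrite ltr_wpDl.
have V : 0 < `|dot s v| / (`|dot w v| + 1) by rewrite divr_gt0 // normr_gt0.
exists (Num.min eps (`|dot s v| / (`|dot w v| + 1))); first by rewrite lt_min e0.
move=> x; rewrite inE => /orP[/eqP-> _|/IH H /H].
  have : Num.min eps (`|dot s v| / (`|dot w v| + 1)) * (`|dot w v| + 1) <= `|dot s v|.
    by rewrite -ler_pdivlMr // ge_min lexx orbT.
  have := V; have : 0 < Num.min eps (`|dot s v| / (`|dot w v| + 1)) by rewrite lt_min e0.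
  move: (Num.min _ _) => mm; lra.
apply: le_lt_trans; apply: ler_wpM2r => //.
by rewrite ge_min lexx.
Qed.

(* The vectors orthogonal to rot v0 are the multiples of v0, so moving slightly
   off rot v0 in the direction -v0 makes every nonzero v in L non-orthogonal. *)
Lemma perturb v0 (L : seq (pt R)) : v0 != (0, 0) ->
  exists2 t, dot t v0 < 0 & forall v, v \in L ->
    [/\ v != (0, 0) -> dot t v != 0,
        0 < dot (rot v0) v -> 0 < dot t v
      & dot (rot v0) v < 0 -> dot t v < 0].
Proof.
move=> v00; have N := pt_neq0 v00.
have [eps e0 H] := small_scale (rot v0) v0 L.
pose t : pt R := ((rot v0).1 - eps * v0.1, (rot v0).2 - eps * v0.2).
have tE v : dot t v = dot (rot v0) v - eps * dot v0 v by rewrite /dot /=; ring.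
exists t.
  have -> : dot t v0 = - (eps * (v0.1 ^+ 2 + v0.2 ^+ 2)) by rewrite /dot /=; ring.
  by rewrite oppr_lt0 mulr_gt0.
move=> v vL; have {}H := H v vL.
have K : dot (rot v0) v != 0 -> `|eps * dot v0 v| < `|dot (rot v0) v|.
  by move=> nz; rewrite normrM (gtr0_norm e0) H.
have P1 : 0 < dot (rot v0) v -> 0 < dot t v.
  move=> p; move: (K (lt0r_neq0 p)); rewrite (gtr0_norm p) ltr_norml tE; lra.
have P2 : dot (rot v0) v < 0 -> dot t v < 0.
  move=> p; move: (K (ltr0_neq0 p)); rewrite (ltr0_norm p) ltr_norml tE; lra.
split=> // nz; case: (ltgtP (dot (rot v0) v) 0) => [/P2/ltr0_neq0|/P1/lt0r_neq0|z] //.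
rewrite tE z sub0r oppr_eq0 mulf_eq0 (gt_eqF e0) /=.
apply: contra nz => /eqP z2; case: v z z2 {vL H K P1 P2} => x y.
rewrite /dot /= => z z2.
have /eqP : (v0.1 ^+ 2 + v0.2 ^+ 2) * x = 0.
  transitivity (v0.1 * (v0.1 * x + v0.2 * y) - v0.2 * (- v0.2 * x + v0.1 * y)); first by ring.
  by rewrite z z2; ring.
have /eqP : (v0.1 ^+ 2 + v0.2 ^+ 2) * y = 0.
  transitivity (v0.2 * (v0.1 * x + v0.2 * y) + v0.1 * (- v0.2 * x + v0.1 * y)); first by ring.
  by rewrite z z2; ring.
by rewrite !mulf_eq0 (gt_eqF N) /= => /eqP-> /eqP->.
Qed.

(** Vectors with sum zero are the sides of a triangle; centred at the origin and scaled up, it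
    swallows any finite set. *)
Lemma enclosing_triangle (n : nat) (P : 'I_n -> pt R) (A B C : pt R) :
  A.1 + B.1 + C.1 = 0 -> A.2 + B.2 + C.2 = 0 -> 0 < cross A B ->
  exists l v0 v1 v2, [/\ 0 < l, forall i, in_triangle v0 v1 v2 (P i) &
    [/\ sub v1 v0 = (l * A.1, l * A.2), sub v2 v1 = (l * B.1, l * B.2)
      & sub v0 v2 = (l * C.1, l * C.2)]].
Proof.
move=> S1 S2 K0; set K := cross A B in K0.
have c1 : C.1 = - A.1 - B.1 by lra.
have c2 : C.2 = - A.2 - B.2 by lra.
pose g i : R := `|cross A (P i)| + `|cross B (P i)| + `|cross C (P i)|.
pose M : R := \sum_i g i + 1.
have gM i : g i < M.
  rewrite /M (bigD1 i) //= -addrA ltrDl ltr_wpDl // sumr_ge0 // => j _.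
  by rewrite !addr_ge0.
have M0 : 0 < M by rewrite ltr_wpDl // sumr_ge0 // => j _; rewrite !addr_ge0.
(* The orientation of [P i] against the side along [D] will be [3 * l * (cross D (P i) + l * K)], so
   [l * K] has to exceed every [cross D (P i)] in absolute value. *)
have [l l0 lK] : exists2 l, 0 < l & l * K = M.
  by exists (M / K); rewrite ?divfK ?gt_eqF ?divr_gt0.
(* The centroid is the origin; since the sum of [A], [B], [C] is zero, the sides are [3 * l] times
   [A], [B], [C]. *)
pose v0 : pt R := (l * (C.1 - A.1), l * (C.2 - A.2)).
pose v1 : pt R := (l * (A.1 - B.1), l * (A.2 - B.2)).
pose v2 : pt R := (l * (B.1 - C.1), l * (B.2 - C.2)).
exists (3 * l), v0, v1, v2.
have bound i D : `|cross D (P i)| <= g i -> 0 < 3 * l * (cross D (P i) + l * K).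
  move=> h; have := le_lt_trans h (gM i); rewrite ltr_norml => /andP[h1 _].
  by rewrite lK mulr_gt0 ?mulr_gt0 ?ltr0n //; lra.
split; first by rewrite mulr_gt0.
  move=> i; left; split.
    suff -> : orient v0 v1 v2 = 9 * l ^+ 2 * K by rewrite !mulr_gt0 ?exprn_gt0.
    by rewrite /K /orient /cross /= c1 c2; ring.
  split; [|split].
  - suff -> : orient v0 v1 (P i) = 3 * l * (cross A (P i) + l * K).
      by apply: bound; rewrite /g -addrA lerDl addr_ge0.
    by rewrite /K /orient /cross /= c1 c2; ring.
  - suff -> : orient v1 v2 (P i) = 3 * l * (cross B (P i) + l * K).
      by apply: bound; rewrite /g addrAC lerDr addr_ge0.
    by rewrite /K /orient /cross /= c1 c2; ring.
  suff -> : orient v2 v0 (P i) = 3 * l * (cross C (P i) + l * K).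
    by apply: bound; rewrite /g lerDr addr_ge0.
  by rewrite /K /orient /cross /= c1 c2; ring.
by split; rewrite /sub /= c1 c2; congr pair; ring.
Qed.

(** The weights [cross b c], [cross c a], [cross a b] are positive and turn [a], [b], [c] into
    vectors with sum zero. *)
Lemma triangle (n : nat) (P : 'I_n -> pt R) (a b c : pt R) :
  0 < cross a b -> 0 < cross b c -> 0 < cross c a ->
  exists v0 v1 v2, (forall i, in_triangle v0 v1 v2 (P i)) /\
    exists ka kb kc : R, [/\ 0 < ka, 0 < kb & 0 < kc] /\
    [/\ sub v1 v0 = (ka * a.1, ka * a.2), sub v2 v1 = (kb * b.1, kb * b.2)
      & sub v0 v2 = (kc * c.1, kc * c.2)].
Proof.
move=> ab bc ca.
have [|||l [v0 [v1 [v2 [l0 inT [s0 s1 s2]]]]]] := @enclosing_triangle n P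
  (cross b c * a.1, cross b c * a.2) (cross c a * b.1, cross c a * b.2)
  (cross a b * c.1, cross a b * c.2).
- by rewrite /cross /=; ring.
- by rewrite /cross /=; ring.
- have -> : cross (cross b c * a.1, cross b c * a.2) (cross c a * b.1, cross c a * b.2)
    = cross a b * cross b c * cross c a by rewrite /cross /=; ring.
  by rewrite !mulr_gt0.
exists v0, v1, v2; split=> //.
exists (l * cross b c), (l * cross c a), (l * cross a b).
by rewrite s0 s1 s2 /= !mulrA; split; split=> //; rewrite mulr_gt0.
Qed.

(** Used for directions attached to consecutive vertices of the hull triangle: they turn
    counterclockwise. *)
Lemma cross_ccw t u (a b c : pt R) : 0 < orient a b c ->
  dot t b < dot t a < dot t c -> dot u c < dot u b < dot u a -> 0 < cross t u.
Proof.
move=> o /andP[t1 t2] /andP[u1 u2]; rewrite -(pmulr_lgt0 _ o) cross_dot subr_gt0.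
apply: (@lt_trans _ _ 0); first by rewrite pmulr_rlt0 ?subr_lt0 ?subr_gt0.
by rewrite nmulr_rgt0 subr_lt0 // (lt_trans u1).
Qed.

Lemma proj_coord_lt u w d (k : R) x y : sub w u = (k * d.1, k * d.2) -> 0 < k ->
  (proj_coord u w x < proj_coord u w y) = (dot d x < dot d y).
Proof.
move=> [E1 E2] k0; rewrite /proj_coord E1 E2 -subr_gt0 -[RHS]subr_gt0 -[RHS](pmulr_rgt0 _ k0).
by congr (_ < _); rewrite /dot; ring.
Qed.

End Plane.

(** * Ranks of points in a rotating direction *)

Section Points.
Variables (R : realType) (n : nat) (P : 'I_n -> pt R).
Hypothesis Pinj : injective P.
Hypothesis gp : general_position P.
Implicit Types (S : {set 'I_n}) (i j p r : 'I_n) (d e t : pt R) (k : nat).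

Definition below S d i := [set r in S | dot d (P r) < dot d (P i)].
Definition right S i j := [set r in S | orient (P i) (P j) (P r) < 0].
Definition generic d := forall i j, i != j -> dot d (P i) != dot d (P j).

(** A discrete intermediate value theorem: as the direction moves from [d0] to [d1], the rank of [i]
    grows only when some [j] drops below [i], one point at a time, so some [j] drops when the rank
    is exactly [k]. *)
Lemma crossing S i d0 d1 k : 0 < cross d0 d1 ->
  (#|below S d0 i| <= k)%N -> (k < #|below S d1 i|)%N ->
  exists j, [/\ j \in S, #|right S i j| = k,
    dot d0 (P i) <= dot d0 (P j) & dot d1 (P j) < dot d1 (P i)].
Proof.
move=> D H0 H1.
pose A j := dot d0 (P j) - dot d0 (P i).
pose B j := dot d1 (P j) - dot d1 (P i).
(* The points below [i] in the direction [(1 - s) * d0 + s * d1]. Those in [X] pass from above to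
   below, and [tau] is the time when they are level with [i]. *)
pose C s := [set j in S | A j + s * (B j - A j) < 0].
pose X := [set j in S | (0 <= A j) && (B j < 0)].
pose tau j := A j / (A j - B j).
have C0 : C 0 = below S d0 i.
  by apply/setP=> j; rewrite !inE mul0r addr0 subr_lt0.
have C1 : C 1 = below S d1 i.
  by apply/setP=> j; rewrite !inE mul1r addrC subrK subr_lt0.
have key j r : cross d0 d1 * orient (P i) (P j) (P r) = A j * B r - A r * B j.
  exact: cross_dot.
have Cright j : j \in X -> C (tau j) = right S i j.
  rewrite inE => /and3P[_ Aj Bj]; apply/setP=> r; rewrite !inE; congr (_ && _).
  have Dj : 0 < A j - B j by lra.
  rewrite -[RHS](pmulr_rlt0 _ D) key -[LHS](pmulr_rlt0 _ Dj); congr (_ < 0).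
  by rewrite /tau; field; rewrite gt_eqF.
(* Two points level with [i] at the same time would be collinear with it. *)
have tau_inj j r : j \in X -> r \in X -> tau j = tau r -> j = r.
  rewrite !inE => /and3P[_ Aj Bj] /and3P[_ Ar Br] E.
  have nij : i != j by apply: contraTneq Bj => <-; rewrite /B subrr ltxx.
  have nir : i != r by apply: contraTneq Br => <-; rewrite /B subrr ltxx.
  apply/eqP; apply: contraT => njr.
  have := mulf_neq0 (lt0r_neq0 D) (gp nij njr nir); rewrite key.
  have Dj : A j - B j != 0 by rewrite gt_eqF //; lra.
  have Dr : A r - B r != 0 by rewrite gt_eqF //; lra.
  move: E; rewrite /tau => /eqP; rewrite eqr_div // => /eqP E.
  suff -> : A j * B r - A r * B j = 0 by rewrite eqxx.
  by lra.
have sub s s' j : 0 <= s -> s <= s' -> s' <= 1 -> j \in C s' ->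
    j \in C s \/ [/\ j \in X, s <= tau j & tau j < s'].
  move=> s0 ss s1; rewrite !inE => /andP[-> /= f'].
  case: (ltP (A j + s * (B j - A j)) 0) => f; [by left|right].
  have BA : 0 < A j - B j by nra.
  rewrite /tau ler_pdivlMr // ltr_pdivrMr //; split; [apply/andP; split; nra|nra|nra].
have [j1 j1X] : exists j1, j1 \in X.
  have /subsetPn[j] : ~~ (C 1 \subset C 0).
    by apply/negP=> /subset_leq_card; rewrite C0 C1; lia.
  case/(sub 0 1 j (lexx _) ler01 (lexx _)) => [->//|[jX _ _] _]; by exists j.
have tau01 j : j \in X -> 0 <= tau j < 1.
  rewrite inE => /and3P[_ Aj Bj]; have Dj : 0 < A j - B j by lra.
  rewrite /tau ler_pdivlMr // ltr_pdivrMr //; apply/andP; split; lra.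
(* If [r] is the latest to drop before [s], only [r] itself can be new: it is level with [i], hence
   not yet counted, at time [tau r]. *)
have step s (r : 'I_n) : s <= 1 -> r \in X -> tau r < s ->
    (forall j, j \in X -> tau j < s -> tau j <= tau r) ->
    (#|C s| <= #|C (tau r)|.+1)%N.
  move=> s1 rX ts rmax; have /andP[t0 _] := tau01 r rX.
  apply: leq_trans (subset_leq_card (_ : _ \subset r |: C (tau r))) _.
    apply/subsetP=> j /(sub _ _ _ t0 (ltW ts) s1) [jC|[jX tj tjs]].
      by rewrite in_setU1 jC orbT.
    by rewrite in_setU1 (tau_inj j r) ?eqxx //; apply/le_anti; rewrite tj rmax.
  by rewrite cardsU1 -[X in (_ <= X)%N]add1n leq_add2r leq_b1.
(* The last drop of all belongs to [Y]. The earliest drop in [Y] has rank exactly [k], because the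
   drop before it, or the start, leaves no room for more. *)
pose Y := [set j in X | (k <= #|C (tau j)|)%N].
have [j2 j2Y] : exists j2, j2 \in Y.
  case: (arg_maxP tau j1X) => j jX0 jmax; have jX : j \in X by [].
  exists j; rewrite inE jX /=.
  have /andP[_ t1] := tau01 j jX.
  by rewrite -ltnS; apply: leq_trans H1 _; rewrite -C1; apply: step => // r rX _; apply: jmax.
case: (arg_minP tau j2Y) => j jY jmin.
have /setIdP[jX jk] : j \in Y by [].
have /andP[t0 t1] := tau01 j jX.
exists j; move: (jX); rewrite inE subr_ge0 subr_lt0 => /and3P[jS Aj Bj]; split=> //.
rewrite -Cright //; apply/eqP; rewrite eqn_leq jk andbT.
case: (pickP [pred r in X | tau r < tau j]) => [r0 r0P|none].
  case: (arg_maxP tau r0P) => r /andP[rX rj] rmax.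
  have rk : (#|C (tau r)| < k)%N.
    rewrite ltnNge; apply/negP=> rk; have rY : r \in Y by rewrite inE rX.
    by have := jmin r rY; rewrite leNgt rj.
  apply: leq_trans (step (tau j) r (ltW t1) rX rj _) rk => l lX lj.
  by apply: rmax; rewrite /= lX.
apply: leq_trans H0; rewrite -C0; apply/subset_leq_card/subsetP=> l.
case/(sub 0 _ _ (lexx _) t0 (ltW t1)) => // -[lX _ lj].
by have := none l; rewrite /= lX lj.
Qed.

Lemma card_right S i j : i \in S -> j \in S -> i != j ->
  (#|right S i j| + #|right S j i|).+2 = #|S|.
Proof.
move=> iS jS nij.
have I0 : right S i j :&: right S j i = set0.
  apply/setP=> r; rewrite !inE orientC oppr_lt0.
  by apply/negP=> /andP[/andP[_ a] /andP[_ b]]; have := lt_trans a b; rewrite ltxx.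
have U : right S i j :|: right S j i = S :\: [set i; j].
  apply/setP=> r; rewrite !inE [orient (P j) _ _]orientC oppr_lt0 -andb_orr andbC.
  congr (_ && _); have [->|nri] := eqVneq r i.
    by rewrite /orient !subrr !mulr0 subrr ltxx.
  have [->|nrj] := eqVneq r j.
    by rewrite /orient mulrC subrr ltxx.
  by rewrite -neq_lt gp // eq_sym.
have := cardsUI (right S i j) (right S j i); rewrite I0 cards0 addn0 U => <-.
rewrite cardsD (setIidPr _) ?cards2 ?nij; last by apply/subsetP=> r /set2P[]->.
have : (1 < #|S|)%N by rewrite (cardsD1 i) iS (cardsD1 j) !inE eq_sym nij jS.
lia.
Qed.

Lemma card_below_opp S d i : generic d -> i \in S ->
  (#|below S d i| + #|below S (opp d) i|).+1 = #|S|.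
Proof.
move=> gd iS.
have I0 : below S d i :&: below S (opp d) i = set0.
  apply/setP=> r; rewrite !inE !dot_opp ltrN2.
  by apply/negP=> /andP[/andP[_ a] /andP[_ b]]; have := lt_trans a b; rewrite ltxx.
have U : below S d i :|: below S (opp d) i = S :\ i.
  apply/setP=> r; rewrite !inE !dot_opp ltrN2 -andb_orr andbC -neq_lt.
  by congr (_ && _); have [->|/gd->] := eqVneq r i; rewrite ?eqxx.
have := cardsUI (below S d i) (below S (opp d) i).
by rewrite I0 cards0 addn0 U => <-; rewrite [RHS](cardsD1 i) iS.
Qed.

(** [crossing] needs a turn of less than a half, so the turn is split at [rot d]; the rank there
    tells which quarter to use. *)
Lemma half_turn S i d k :
  (#|below S d i| <= k)%N -> (k < #|below S (opp d) i|)%N ->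
  exists j, [/\ j \in S, j != i, #|right S i j| = k & dot d (P i) <= dot d (P j)].
Proof.
move=> H0 H1.
have D : 0 < d.1 ^+ 2 + d.2 ^+ 2.
  have [d0|/pt_neq0//] := eqVneq d (0, 0).
  suff E : below S (opp d) i = set0 by rewrite E cards0 in H1.
  by apply/setP=> r; rewrite !inE d0 /dot /= oppr0 !mul0r ltxx andbF.
case: (leqP #|below S (rot d) i| k) => H2.
  have [|j [jS jk _]] := crossing (i := i) (d0 := rot d) (d1 := opp d) _ H2 H1.
    by move: D; rewrite /cross /=; lra.
  rewrite !dot_opp ltrN2 => lt; exists j; split=> //; last exact: ltW.
  by apply: contraTneq lt => ->; rewrite ltxx.
have [|j [jS jk le lt]] := crossing (i := i) (d0 := d) (d1 := rot d) _ H0 H2.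
  by move: D; rewrite /cross /=; lra.
by exists j; split=> //; apply: contraTneq lt => ->; rewrite ltxx.
Qed.

(** * Hull vertices and the half turns attached to them *)

Definition minimal S e p := p \in S /\ forall r, r \in S -> r != p -> dot e (P p) < dot e (P r).

(** From [e] to [opp e] the rank of [p] climbs from 0 to [#|S| - 1], through every value. *)
Lemma minimal_half_turn S e p k : minimal S e p -> (k.+1 < #|S|)%N ->
  exists j, [/\ j \in S, j != p & #|right S p j| = k].
Proof.
move=> [pS pmin] kS.
have [||j [*]] := half_turn (S := S) (i := p) (d := e) (k := k); last by exists j.
  suff -> : below S e p = set0 by rewrite cards0.
  apply/setP=> r; rewrite !inE; apply/negP=> /andP[rS].
  have [->|/(pmin r rS)/ltW] := eqVneq r p; first by rewrite ltxx.
  by move=> le; rewrite ltNge le.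
apply: leq_trans (subset_leq_card (_ : S :\ p \subset _)).
  by move: kS; rewrite (cardsD1 p) pS.
apply/subsetP=> r; rewrite !inE => /andP[rp rS]; rewrite rS /= !dot_opp ltrN2.
exact: pmin.
Qed.

(** Input for [perturb]; the zero vectors from equal indices are harmless there. *)
Definition differences := [seq sub (P ij.1) (P ij.2) | ij <- enum [set: 'I_n * 'I_n]].

Lemma mem_differences i j : sub (P i) (P j) \in differences.
Proof. by apply/mapP; exists (i, j); rewrite // mem_enum inE. Qed.

Lemma sub_neq0 i j : i != j -> sub (P i) (P j) != (0, 0).
Proof.
apply: contraNneq => -[] /eqP; rewrite subr_eq0 => /eqP E1 /eqP.
rewrite subr_eq0 => /eqP E2; apply/eqP/Pinj.
by case: (P i) (P j) E1 E2 => [? ?] [? ?] /= -> ->.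
Qed.

(** The normal of the edge is turned just past the moment when [i] and [j] are level; [w] is one
    more vector whose positive sign must survive. *)
Lemma perturb_edge i j (w : pt R) : i != j -> exists t,
  [/\ generic t, dot t (P j) < dot t (P i),
      forall r, 0 < orient (P i) (P j) (P r) -> dot t (P i) < dot t (P r),
      forall r, orient (P i) (P j) (P r) < 0 -> dot t (P r) < dot t (P i)
    & 0 < dot (rot (sub (P j) (P i))) w -> 0 < dot t w].
Proof.
move=> nij; have ji : j != i by rewrite eq_sym.
have [t t1 t2] := perturb (w :: differences) (sub_neq0 ji).
have mem l r : sub (P l) (P r) \in w :: differences by rewrite inE mem_differences orbT.
exists t; split.
- move=> l r lr; case: (t2 _ (mem l r)) => /(_ (sub_neq0 lr)).
  by rewrite dot_sub subr_eq0.
- by rewrite -subr_lt0 -dot_sub.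
- move=> r; rewrite -dot_rot_sub; case: (t2 _ (mem r i)) => _ H _ /H.
  by rewrite dot_sub subr_gt0.
- move=> r; rewrite -dot_rot_sub; case: (t2 _ (mem r i)) => _ _ H /H.
  by rewrite dot_sub subr_lt0.
by case: (t2 w (mem_head _ _)).
Qed.

(** Just after an exchange of [p] with [j] at rank [k], the [k] points on the right and [j] are
    below [p]; the [#|S| - k.+2] points on the left, at least [k.+1] of them, are above. *)
Lemma window S e p k : minimal S e p -> (k.+1.*2 < #|S|)%N ->
  exists t, [/\ generic t, 0 < cross e t, (k < #|below S t p|)%N &
    (k < #|below S (opp t) p|)%N].
Proof.
move=> pmin kS; have [|j [jS jp jk]] := minimal_half_turn (k := k) pmin; first by lia.
have pj : p != j by rewrite eq_sym.
have [t [gt tj pos neg tw]] := perturb_edge (rot e) pj.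
have [pS pm] := pmin.
exists t; split=> //.
- rewrite -dot_rot tw // dot_rot.
  suff -> : cross e (rot (sub (P j) (P p))) = dot e (P j) - dot e (P p) by rewrite subr_gt0 pm.
  by rewrite /cross /dot /=; ring.
- rewrite -jk; apply: (@leq_trans #|j |: right S p j|).
    by rewrite cardsU1 inE /orient mulrC subrr ltxx andbF.
  apply/subset_leq_card/subsetP=> r; rewrite !inE => /orP[/eqP->|/andP[->/neg//]].
  by rewrite jS.
have := card_right pS jS pj; rewrite jk => C.
apply: (@leq_trans #|right S j p|); first by lia.
apply/subset_leq_card/subsetP=> r; rewrite !inE orientC oppr_lt0 => /andP[->/pos].
by rewrite !dot_opp ltrN2.
Qed.

(* While the direction turns from t to -t, the rank of p first increases up to
   its maximum and then decreases to the rank of p in direction -t. *)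
Lemma window_right S e p t k i j : minimal S e p -> 0 < cross e t ->
  (k < #|below S t p|)%N -> (k < #|below S (opp t) p|)%N ->
  #|right S i j| = k -> dot t (P i) < dot t (P j) ->
  0 < orient (P i) (P j) (P p).
Proof.
move=> [pS pmin] et bt bo rk ij; rewrite ltNge; apply/negP=> op.
pose s := rot (sub (P j) (P i)).
have sE r : orient (P i) (P j) (P r) = dot s (P r) - dot s (P i).
  by rewrite /s -dot_rot_sub dot_sub.
(* If [p] is not on the left of the edge, all points below [p] in the normal direction [s] are on
   its right, where there are only [k]. *)
suff : (k < #|below S s p|)%N.
  rewrite -rk ltnNge => /negP; apply; apply/subset_leq_card/subsetP=> r.
  rewrite !inE => /andP[-> /=]; move: op; rewrite !sE; lra.
have ts : 0 < cross t s.
  move: ij; rewrite /cross /s /dot /=; lra.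
have key r : cross e t * (dot s (P r) - dot s (P p)) =
    cross e s * (dot t (P r) - dot t (P p)) - cross t s * (dot e (P r) - dot e (P p)).
  by rewrite /cross /dot; ring.
(* Until [s] reaches [opp e], it is a nonnegative combination of [t] and [opp e], and points below
   [p] in direction [t] stay below; afterwards [opp t] takes the place of [t]. *)
case: (leP 0 (cross e s)) => es.
  apply: leq_trans bt _; apply/subset_leq_card/subsetP=> r.
  rewrite !inE => /andP[rS rt]; rewrite rS /=.
  have rp : r != p by apply: contraTneq rt => ->; rewrite ltxx.
  have re := pmin r rS rp; have := key r.
  have : 0 < cross t s * (dot e (P r) - dot e (P p)) by rewrite mulr_gt0 // subr_gt0.
  have : 0 <= cross e s * (dot t (P p) - dot t (P r)) by rewrite mulr_ge0 // subr_ge0 ltW.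
  move=> a b c; rewrite -subr_lt0 -(pmulr_rlt0 _ et) c; lra.
apply: leq_trans bo _; apply/subset_leq_card/subsetP=> r.
rewrite !inE !dot_opp ltrN2 => /andP[rS rt]; rewrite rS /=.
have rp : r != p by apply: contraTneq rt => ->; rewrite ltxx.
have re := pmin r rS rp; have := key r.
have : 0 < cross t s * (dot e (P r) - dot e (P p)) by rewrite mulr_gt0 // subr_gt0.
have : cross e s * (dot t (P r) - dot t (P p)) < 0 by rewrite nmulr_rlt0 // subr_gt0.
move=> a b c; rewrite -subr_lt0 -(pmulr_rlt0 _ et) c; lra.
Qed.

(** * Counting exchanges and the lower bound *)

Definition lowest S d k := [set i in S | (#|below S d i| <= k)%N].

Lemma below_sub S d i j : i \in S -> dot d (P i) < dot d (P j) ->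
  (#|below S d i| < #|below S d j|)%N.
Proof.
move=> iS ij; apply/proper_card/properP; split.
  by apply/subsetP=> r; rewrite !inE => /andP[-> /lt_trans]; apply.
by exists i; rewrite !inE ?iS ?ltxx.
Qed.

(** In a generic direction the ranks are a permutation of [0, ..., #|S| - 1]. *)
Lemma card_lowest S d k : generic d -> (k < #|S|)%N -> #|lowest S d k| = k.+1.
Proof.
move=> gd kS; pose s := [seq #|below S d i| | i in S].
have us : uniq s.
  rewrite map_inj_in_uniq ?enum_uniq // => i j; rewrite !mem_enum => iS jS E.
  apply/eqP; apply: contraT => /gd; rewrite neq_lt => /orP[/(below_sub iS)|/(below_sub jS)];
  by rewrite E ltnn.
have ss : {subset s <= iota 0 #|S|}.
  move=> x /mapP[i]; rewrite mem_enum => iS ->; rewrite mem_iota /= add0n.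
  apply/proper_card/properP; split; first by apply/subsetP=> r; rewrite inE => /andP[].
  by exists i; rewrite // inE ltxx andbF.
have sz : size (iota 0 #|S|) = size s by rewrite size_iota size_map -cardE.
have [_ eqs] := uniq_min_size us ss (eq_leq sz).
have pe : perm_eq s (iota 0 #|S|) by apply: uniq_perm; rewrite ?iota_uniq.
have -> : #|lowest S d k| = count (fun x => x <= k)%N s.
  rewrite cardE /s /image_mem count_map -size_filter /enum_mem -filter_predI.
  by congr size; apply: eq_filter => i; rewrite /= !inE andbC.
rewrite (permP pe) -(subnKC kS) iotaD count_cat.
rewrite (_ : count _ (iota 0 _) = k.+1); last first.
  rewrite -[RHS](size_iota 0); apply/eqP; rewrite -all_count; apply/allP=> x.
  by rewrite mem_iota.
rewrite (_ : count _ _ = 0%N) ?addn0 //; apply/eqP; rewrite -leqn0 leqNgt -has_count.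
by apply/hasPn=> x; rewrite mem_iota add0n -ltnNge => /andP[].
Qed.

Definition edges S k := [set ij : 'I_n * 'I_n |
  [&& ij.1 \in S, ij.2 \in S, ij.1 != ij.2 & #|right S ij.1 ij.2| == k]].
Definition edges_lt S k := [set ij : 'I_n * 'I_n |
  [&& ij.1 \in S, ij.2 \in S, ij.1 != ij.2 & (#|right S ij.1 ij.2| < k)%N]].
(** As [cross t (rot v) = dot t v], these are the exchanges during the open half turn from [t] to
    [opp t]. *)
Definition rising S t k := [set ij in edges S k | dot t (P ij.1) < dot t (P ij.2)].
Definition away S p k := [set ij in edges S k | 0 < orient (P ij.1) (P ij.2) (P p)].

Lemma card_edges_ltS S k : #|edges_lt S k.+1| = (#|edges_lt S k| + #|edges S k|)%N.
Proof.
rewrite -cardsUI (_ : _ :&: _ = set0) ?cards0 ?addn0.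
  apply: eq_card => ij; rewrite !inE ltnS leq_eqVlt.
  by case: (_ \in S); case: (_ \in S); case: (_ != _); rewrite //= orbC.
apply/setP=> ij; rewrite !inE; apply/negP=> /andP[/and4P[_ _ _ a] /and4P[_ _ _ /eqP b]].
by rewrite b ltnn in a.
Qed.

(** Each of the [k.+1] lowest points has rank above [k] in direction [opp t], so each is the tail of
    an exchange. *)
Lemma card_rising S t k : generic t -> (k.+1.*2 <= #|S|)%N -> (k < #|rising S t k|)%N.
Proof.
move=> gt kS; rewrite -(card_lowest (S := S) (k := k) gt); last by lia.
apply: leq_trans (leq_imset_card fst (rising S t k)).
apply/subset_leq_card/subsetP=> i; rewrite inE => /andP[iS ik].
have [|j [jS ji jk le]] := half_turn ik.
  by have := card_below_opp gt iS; lia.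
apply/imsetP; exists (i, j) => //; rewrite !inE iS jS eq_sym ji jk eqxx /=.
by rewrite lt_neqAle gt // eq_sym.
Qed.

Lemma rising_away S e p t k : minimal S e p -> 0 < cross e t ->
  (k < #|below S t p|)%N -> (k < #|below S (opp t) p|)%N ->
  rising S t k \subset away S p k.
Proof.
move=> pm et b1 b2; apply/subsetP=> ij; rewrite !inE => /andP[E lt].
rewrite E; case/and4P: E => _ _ _ /eqP E.
exact: window_right pm et b1 b2 E lt.
Qed.

Lemma card_away S e p k : minimal S e p -> (k.+1.*2 < #|S|)%N -> (k < #|away S p k|)%N.
Proof.
move=> pm kS; have [t [gt et b1 b2]] := window pm kS.
apply: leq_trans (subset_leq_card (rising_away pm et b1 b2)).
by apply: card_rising => //; apply: ltnW.
Qed.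

Lemma leq_card_values (T : finType) (A : {set T}) (f : T -> nat) k :
  (forall l, (l < k)%N -> exists2 x, x \in A & f x = l) -> (k <= #|A|)%N.
Proof.
move=> H; rewrite -(size_iota 0 k) cardE -(size_map f); apply: uniq_leq_size.
  exact: iota_uniq.
move=> l; rewrite mem_iota add0n => /andP[_ /H[x xA <-]].
by apply: map_f; rewrite mem_enum.
Qed.

(** Four disjoint families are counted: [k.+1] edges leaving [p], [k.+1] entering it, the edges of
    [S :\ p], whose right side gains at most [p], and those in [away], which keep [k] points on the
    right without [p]. *)
Lemma edges_lt_step S e p k : minimal S e p -> (k.+1.*2 < #|S|)%N ->
  (#|edges_lt (S :\ p) k| + k.+1.*2 + #|away S p k| <= #|edges_lt S k.+1|)%N.
Proof.
move=> pm kS; have [pS _] := pm.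
have turn l : (l.+1 < #|S|)%N -> exists j, [/\ j \in S, j != p & #|right S p j| = l].
  exact: minimal_half_turn pm.
pose O := [set ij in edges_lt S k.+1 | ij.1 == p].
pose I := [set ij in edges_lt S k.+1 | ij.2 == p].
have cO : (k.+1 <= #|O|)%N.
  apply: (@leq_card_values _ _ (fun ij => #|right S ij.1 ij.2|)) => l lk.
  have [|j [jS jp jl]] := turn l; first by lia.
  by exists (p, j); rewrite // !inE /= pS jS eq_sym jp jl ltnS eqxx andbT.
have cI : (k.+1 <= #|I|)%N.
  apply: (@leq_card_values _ _ (fun ij => #|right S ij.1 ij.2|)) => l lk.
  (* Reversing an edge with this many points on the right leaves [l] on the right. *)
  have [|j [jS jp jl]] := turn (#|S| - l.+2)%N; first by lia.
  have := card_right jS pS jp; rewrite jl => C.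
  have E : #|right S j p| = l by lia.
  by exists (j, p); rewrite // !inE /= pS jS jp E ltnS eqxx andbT.
have rD i j : ~~ (orient (P i) (P j) (P p) < 0) -> right S i j = right (S :\ p) i j.
  move=> np; apply/setP=> r; rewrite !inE.
  by have [->|//] := eqVneq r p; rewrite (negbTE np) andbF.
have rle i j : (#|right S i j| <= (#|right (S :\ p) i j|).+1)%N.
  apply: leq_trans (subset_leq_card (_ : _ \subset p |: right (S :\ p) i j)) _.
    by apply/subsetP=> r; rewrite !inE; case: eqP.
  by rewrite cardsU1 -[X in (_ <= X)%N]add1n leq_add2r leq_b1.
have disj (A B : {set 'I_n * 'I_n}) : A :&: B = set0 -> (#|A| + #|B| = #|A :|: B|)%N.
  by move=> AB; rewrite -cardsUI AB cards0 addn0.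
have aN1 ij : ij \in away S p k -> (ij.1 != p) && (ij.2 != p).
  rewrite inE => /andP[_]; apply: contraLR; rewrite negb_and !negbK.
  by case/orP=> /eqP ->; rewrite /orient ?subrr ?mulr0 ?subrr ?ltxx // mulrC subrr ltxx.
have lN1 ij : ij \in edges_lt (S :\ p) k -> (ij.1 != p) && (ij.2 != p).
  by rewrite !inE => /and4P[/andP[-> _] /andP[-> _] _ _].
have E1 : edges_lt (S :\ p) k :&: away S p k = set0.
  apply/setP=> ij; rewrite in_setI in_set0; apply/negP=> /andP[].
  rewrite !inE => /and4P[_ _ _ lt] /andP[/and4P[_ _ _ /eqP E] pos].
  by move: lt; rewrite -rD ?E ?ltnn // -leNgt ltW.
have E2 : O :&: I = set0.
  apply/setP=> -[i j]; rewrite !inE /=; apply/negP.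
  by case/andP=> /andP[/and4P[_ _ ij _] /eqP ip] /andP[_ /eqP jp]; rewrite ip jp eqxx in ij.
have E3 : (O :|: I) :&: (edges_lt (S :\ p) k :|: away S p k) = set0.
  apply/setP=> ij; rewrite in_setI !in_setU in_set0; apply/negP=> /andP[OI LA].
  have /andP[n1 n2] : (ij.1 != p) && (ij.2 != p) by case/orP: LA => [/lN1|/aN1].
  by move: OI; rewrite !in_set (negbTE n1) (negbTE n2) !andbF.
have {cO cI} : (k.+1.*2 <= #|O :|: I|)%N by rewrite -disj // -addnn leq_add.
move=> cOI; apply: (@leq_trans #|(O :|: I) :|: (edges_lt (S :\ p) k :|: away S p k)|).
  by rewrite -(disj _ _ E3) -(disj _ _ E1) addnAC addnC leq_add2r.
apply/subset_leq_card/subsetP=> ij; rewrite !in_setU => /orP[/orP[]|/orP[]].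
- by rewrite inE => /andP[].
- by rewrite inE => /andP[].
- rewrite !inE => /and4P[/andP[_ ->] /andP[_ ->] -> lt] /=.
  by apply: leq_ltn_trans (rle _ _) _; rewrite ltnS.
by rewrite !inE => /andP[/and4P[-> -> -> /eqP->] _]; rewrite ltnSn.
Qed.

Lemma exists_minimal S : (0 < #|S|)%N -> exists e p, minimal S e p.
Proof.
case/card_gt0P=> i iS.
have [|e _ He] := @perturb R (1, 0) differences.
  by rewrite xpair_eqE oner_eq0.
case: (arg_minP (fun r => dot e (P r)) iS) => p pS pmin; exists e, p; split=> // r rS rp.
rewrite lt_neqAle pmin // andbT.
have [/(_ (sub_neq0 rp))] := He _ (mem_differences r p).
by rewrite dot_sub subr_eq0 eq_sym.
Qed.

(** Deleting a hull vertex costs [2 * k.+1] edges at it and at least [k.+1] in [away], which is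
    three times the increment of the binomial. *)
Lemma edges_lt_lower_bound S k : (k.*2 < #|S|)%N -> (3 * 'C(k.+1, 2) <= #|edges_lt S k|)%N.
Proof.
elim: k S => [|k IH] S kS; first by rewrite bin_small.
have [|e [p pm]] := exists_minimal (S := S); first by lia.
have [pS _] := pm.
have := IH (S :\ p); have := edges_lt_step pm kS; have := card_away pm kS.
move: kS; rewrite (cardsD1 p S) pS add1n (binS k.+1) bin1 => kS Q step lb.
have {}lb := lb (ltnW kS).
by rewrite mulnDr; apply: leq_trans step; rewrite -addnn; lia.
Qed.

(** * Unordered edges against oriented ones *)

Lemma nright_right i j : nright P (P i) (P j) = #|right setT i j|.
Proof. by apply: eq_card => r; rewrite !inE. Qed.

Lemma nleft_right i j : nleft P (P i) (P j) = #|right setT j i|.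
Proof. by apply: eq_card => r; rewrite !inE orientC oppr_gt0. Qed.

(** With so many points the two sides of a line cannot both have [k], so each counted line has
    exactly one orientation with [k] on the right. *)
Lemma E_edges k : (k.*2.+2 < n)%N -> E P k = #|edges setT k|.
Proof.
move=> kn.
pose X := [set ij : 'I_n * 'I_n | (ij.1 < ij.2)%N && (#|right setT ij.2 ij.1| == k)].
pose Y := [set ij : 'I_n * 'I_n | (ij.1 < ij.2)%N && (#|right setT ij.1 ij.2| == k)].
pose swap (ij : 'I_n * 'I_n) := (ij.2, ij.1).
have neq (i j : 'I_n) : (i < j)%N -> i != j by apply: contraTneq => ->; rewrite ltnn.
have XY : X :&: Y = set0.
  apply/setP=> ij; rewrite !inE; apply/negP.
  case/andP=> /andP[lt /eqP x] /andP[_ /eqP y].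
  have := card_right (in_setT ij.1) (in_setT ij.2) (neq _ _ lt).
  rewrite x y cardsT card_ord; lia.
have -> : E P k = #|X :|: Y|.
  by apply: eq_card => ij; rewrite !inE nleft_right nright_right -andb_orr.
have swapK : involutive swap by case.
have -> : edges setT k = (swap @: X) :|: Y.
  apply/setP=> -[i j]; rewrite !inE /=.
  have -> : ((i, j) \in swap @: X) = ((j, i) \in X).
    by rewrite -(mem_imset X (j, i) (inv_inj swapK)).
  rewrite inE /=; case: (ltngtP i j) => [/neq->|/neq|/ord_inj->]; rewrite ?eqxx //=.
  by rewrite eq_sym orbF => ->.
have SY : swap @: X :&: Y = set0.
  apply/setP=> ij; rewrite in_setI in_set0; apply/negP=> /andP[/imsetP[ji]].
  by rewrite !inE => /andP[lt _] -> /andP[/= gt _]; have := ltn_trans lt gt; rewrite ltnn.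
have := cardsUI X Y; have := cardsUI (swap @: X) Y.
by rewrite XY SY !cards0 !addn0 card_imset; [move=> -> -> | exact: inv_inj].
Qed.

Lemma edges_lt0 S : edges_lt S 0 = set0.
Proof. by apply/setP=> ij; rewrite !inE !andbF. Qed.

Lemma E_le_edges_lt k : (k.*2.+2 < n)%N -> E_le P k = #|edges_lt setT k.+1|.
Proof.
rewrite /E_le; elim: k => [|k IH] kn.
  by rewrite big_ord1 E_edges // card_edges_ltS edges_lt0 cards0.
rewrite big_ord_recr /= IH ?E_edges -?card_edges_ltS //.
by apply: ltn_trans kn; rewrite doubleS.
Qed.

(** * The hull triangle *)

Lemma edge_minimal S i j : (i, j) \in edges S 0 -> exists e, minimal S e j.
Proof.
rewrite inE /= => /and4P[iS jS ij /eqP/cards0_eq r0].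
have [t [_ t1 t2 _ _]] := perturb_edge (0, 0) ij.
exists t; split=> // r rS rj; have [->//|ri] := eqVneq r i.
apply: lt_trans t1 (t2 r _); rewrite lt_neqAle eq_sym gp //; try by rewrite eq_sym.
have /setP/(_ r) := r0; rewrite !inE rS /= => /negbT; by rewrite -leNgt.
Qed.

Lemma minimal_edge S e p : minimal S e p -> (1 < #|S|)%N -> exists j, (p, j) \in edges S 0.
Proof.
move=> pm S1; have [j [jS jp j0]] := minimal_half_turn (k := 0) pm S1.
by exists j; rewrite inE /= jS j0 eq_sym jp andbT /=; case: pm.
Qed.

(** The head of a hull edge is the tail of another, so the hull can be walked; a walk not closed
    after three steps would use four distinct edges. *)
Lemma hull_triangle S : (2 < #|S|)%N -> #|edges S 0| = 3%N ->
  exists a b c, [/\ (a, b) \in edges S 0, (b, c) \in edges S 0 & (c, a) \in edges S 0].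
Proof.
move=> S2 E3.
have next i j : (i, j) \in edges S 0 -> exists l, (j, l) \in edges S 0.
  by case/edge_minimal=> e /minimal_edge; apply; apply: ltnW.
have noback i j : (i, j) \in edges S 0 -> (j, i) \in edges S 0 -> False.
  rewrite !inE /= => /and4P[iS jS ij /eqP r1] /and4P[_ _ _ /eqP r2].
  by have := card_right iS jS ij; rewrite r1 r2 => E; rewrite -E in S2.
have neq i j : (i, j) \in edges S 0 -> i != j by rewrite inE => /and4P[].
have [|e [a /minimal_edge[|b ab]]] := exists_minimal (S := S); try by lia.
have [c bc] := next _ _ ab; have [d cd] := next _ _ bc; have [x dx] := next _ _ cd.
exists a, b, c; split=> //; have [->//|da] := eqVneq a d.
have ca : a != c by apply: contraTneq bc => <-; apply/negP => /(noback _ _ ab).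
have db : b != d by apply: contraTneq cd => <-; apply/negP => /(noback _ _ bc).
have : (#|[set (a, b); (b, c); (c, d); (d, x)]| <= 3)%N.
  by rewrite -E3; apply/subset_leq_card/subsetP=> y; rewrite !in_setU !in_set1 -!orbA => /or4P[] /eqP->.
rewrite -!setUA !cardsU1 cards1 !inE !xpair_eqE.
by rewrite (negbTE (neq _ _ ab)) (negbTE ca) (negbTE da) (negbTE (neq _ _ bc)) (negbTE db) (negbTE (neq _ _ cd)).
Qed.

(** Seen from [a], the points [b] and [c] are the angular extremes of [S], so they lie on the two
    sides as soon as both sides contain points. *)
Lemma hull_neighbours S e t a b c : minimal S e a ->
  (a, b) \in edges S 0 -> (c, a) \in edges S 0 -> 0 < cross e t ->
  (0 < #|below S t a|)%N -> (0 < #|below S (opp t) a|)%N ->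
  dot t (P b) < dot t (P a) < dot t (P c).
Proof.
move=> [aS am]; rewrite !inE /=.
case/and4P=> _ bS ab /eqP/cards0_eq/setP b0 /and4P[cS _ ca /eqP/cards0_eq/setP c0] et.
case/card_gt0P=> r; rewrite inE => /andP[rS rt].
case/card_gt0P=> l; rewrite inE !dot_opp ltrN2 => /andP[lS lt].
have re : dot e (P a) < dot e (P r) by apply: am => //; apply: contraTneq rt => ->; rewrite ltxx.
have le : dot e (P a) < dot e (P l) by apply: am => //; apply: contraTneq lt => ->; rewrite ltxx.
have be : dot e (P a) < dot e (P b) by apply: am => //; rewrite eq_sym.
have ce : dot e (P a) < dot e (P c) by apply: am.
have := b0 r; rewrite !inE rS /= => /negbT; rewrite -leNgt => {}b0.
have := c0 l; rewrite !inE lS /= => /negbT; rewrite -leNgt orient_cycle => {}c0.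
have := mulr_ge0 (ltW et) b0; rewrite cross_dot => B.
have := mulr_ge0 (ltW et) c0; rewrite -orient_cycle -orient_cycle cross_dot => C.
apply/andP; split; nra.
Qed.

(** * The thirds in the extremal case *)

(* Every edge rises in at least one of the three directions; the cardinalities
   leave no room for an edge rising in two of them. *)
Lemma lowest_opp (ta tb tc : pt R) k : n = (3 * k.+1)%N ->
  generic ta -> generic tb -> generic tc ->
  0 < cross ta tb -> 0 < cross tb tc -> 0 < cross tc ta ->
  #|edges setT k| = (3 * k.+1)%N ->
  (#|rising setT ta k| <= k.+1)%N -> (#|rising setT tb k| <= k.+1)%N ->
  (#|rising setT tc k| <= k.+1)%N ->
  lowest setT ta k = lowest setT (opp tc) k.
Proof.
move=> nk ga gb gc ab bc ca Ek Ra Rb Rc.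
have gc' : generic (opp tc) by move=> i j /gc; rewrite !dot_opp eqr_opp.
have kT : (k < #|[set: 'I_n]|)%N by rewrite cardsT card_ord nk; lia.
have cover : edges setT k \subset rising setT tb k :|: (rising setT ta k :|: rising setT tc k).
  apply/subsetP=> -[i j] ijE; rewrite !in_setU ![_ \in rising _ _ _]inE ijE /=.
  apply: contraT; rewrite !negb_or -!leNgt => /and3P[hb ha hc].
  have /ga na : i != j by move: ijE; rewrite inE => /and4P[].
  have {ha} ha : dot ta (P j) < dot ta (P i) by rewrite lt_neqAle ha eq_sym na.
  (* A linear relation with positive coefficients between [ta], [tb], [tc]: no difference of points
     can descend in all three. *)
  have : cross tb tc * (dot ta (P j) - dot ta (P i)) +
         cross tc ta * (dot tb (P j) - dot tb (P i)) +
         cross ta tb * (dot tc (P j) - dot tc (P i)) = 0 by rewrite /cross /dot; ring.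
  have : cross tb tc * (dot ta (P j) - dot ta (P i)) < 0 by rewrite pmulr_rlt0 // subr_lt0.
  have : cross tc ta * (dot tb (P j) - dot tb (P i)) <= 0 by rewrite pmulr_rle0 // subr_le0.
  have : cross ta tb * (dot tc (P j) - dot tc (P i)) <= 0 by rewrite pmulr_rle0 // subr_le0.
  lra.
have none : rising setT ta k :&: rising setT tc k = set0.
  apply/eqP; rewrite -cards_eq0 -leqn0.
  have := subset_leq_card cover; rewrite Ek.
  have := cardsUI (rising setT ta k) (rising setT tc k).
  have [+ _] := leq_card_setU (rising setT tb k) (rising setT ta k :|: rising setT tc k).
  lia.
(* By equal cardinality one inclusion suffices. A point lost between [ta] and [opp tc] would be the
   tail of an edge rising in both [ta] and [tc]. *)
apply/eqP; rewrite eqEcard !card_lowest // leqnn andbT; apply/subsetP=> i.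
rewrite !inE /= => ia; rewrite leqNgt; apply/negP=> ic.
have [|j [_ jk le lt]] := crossing (d0 := ta) (d1 := opp tc) _ ia ic.
  by move: ca; rewrite /cross /=; lra.
rewrite !dot_opp ltrN2 in lt.
have ij : i != j by apply: contraTneq lt => ->; rewrite ltxx.
have : (i, j) \in rising setT ta k :&: rising setT tc k.
  rewrite in_setI ![_ \in rising _ _ _]inE /= lt andbT !inE /= ij jk eqxx /=.
  by rewrite andbT lt_neqAle ga.
by rewrite none inE.
Qed.

Lemma lowest_lt d k i j : i \in lowest setT d k -> j \notin lowest setT d k ->
  generic d -> dot d (P i) < dot d (P j).
Proof.
move=> il jl gd; have ij : i != j by apply: contraNneq jl => <-.
rewrite lt_neqAle gd //= leNgt; apply/negP=> /(below_sub (in_setT j)) lt.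
by move: il jl; rewrite !inE /= => il; rewrite (leq_trans (ltnW lt) il).
Qed.

Lemma lowest_disjoint d k : generic d -> (k.+1.*2 <= n)%N ->
  [disjoint lowest setT d k & lowest setT (opp d) k].
Proof.
move=> gd kn; rewrite disjoint_subset; apply/subsetP=> i; rewrite !inE /= => ik.
apply/negP=> ok; have /= := card_below_opp gd (in_setT i); rewrite cardsT card_ord => E.
have : (k.+1.*2 <= (k + k).+1)%N by apply: leq_trans kn _; rewrite -E ltnS leq_add.
by rewrite -addnn; lia.
Qed.

(** Equality in the total forces equality in the last induction step, for whichever hull vertex is
    deleted. *)
Lemma card_away_max e p k : minimal setT e p -> (k.+1.*2 < n)%N ->
  #|edges_lt setT k.+1| = (3 * 'C(k.+2, 2))%N -> (#|away setT p k| <= k.+1)%N.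
Proof.
move=> pm kn Ek.
have cT : #|[set: 'I_n]| = n by rewrite cardsT card_ord.
have := edges_lt_step pm; rewrite cT => /(_ _ kn); rewrite Ek (binS k.+1) bin1.
have : (k.*2 < #|[set: 'I_n] :\ p|)%N.
  have := cT; rewrite (cardsD1 p) in_setT add1n => E.
  by apply: ltnW; rewrite -ltnS E -doubleS.
move/edges_lt_lower_bound=> lb step.
have := leq_trans (leq_add (leq_add lb (leqnn k.+1.*2)) (leqnn _)) step.
by rewrite mulnDr -addnA leq_add2l -addnn; lia.
Qed.

Lemma vertex_window a b c k : (k.+1.*2 < n)%N ->
  #|edges_lt setT k.+1| = (3 * 'C(k.+2, 2))%N ->
  (a, b) \in edges setT 0 -> (c, a) \in edges setT 0 ->
  exists t, [/\ generic t, dot t (P b) < dot t (P a) < dot t (P c)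
    & (#|rising setT t k| <= k.+1)%N].
Proof.
move=> kn Ek ab ca; have [e am] := edge_minimal ca.
have [|t [gt et b1 b2]] := window (k := k) am; first by rewrite cardsT card_ord.
exists t; split=> //.
  exact: hull_neighbours am ab ca et (leq_ltn_trans (leq0n _) b1) (leq_ltn_trans (leq0n _) b2).
apply: leq_trans (card_away_max am kn Ek).
by apply/subset_leq_card; apply: rising_away am et b1 b2.
Qed.

End Points.

(** * Assembling the decomposition *)

Theorem theorem1 (R : realType) (n : nat) (P : 'I_n -> pt R) :
  (0 < n)%N -> (3 %| n)%N ->
  injective P ->
  general_position P ->
  (forall k : nat, (3 * k < n)%N -> E_le P k = (3 * 'C(k + 2, 2))%N) ->
  three_decomposable P.
Proof.
move=> n0 /dvdnP[m nm] Pinj gp HE.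
case: m nm => [|k] nm; first by rewrite nm in n0.
have cT : #|[set: 'I_n]| = n by rewrite cardsT card_ord.
have Elt j : (j <= k.+1)%N -> #|edges_lt P setT j| = (3 * 'C(j.+1, 2))%N.
  case: j => [_|j jk]; first by rewrite edges_lt0 cards0.
  by rewrite -E_le_edges_lt // ?HE ?addn2 //; lia.
have Ek : #|edges P setT k| = (3 * k.+1)%N.
  apply/eqP; rewrite -(eqn_add2l #|edges_lt P setT k|) -card_edges_ltS !Elt //.
  by rewrite (binS k.+1) bin1 mulnDr.
have E0 : #|edges P setT 0| = 3%N.
  by have := card_edges_ltS P setT 0; rewrite edges_lt0 cards0 add0n => <-; rewrite Elt.
have kn : (k.+1.*2 < n)%N by lia.
have kT : (k < #|[set: 'I_n]|)%N by rewrite cT; lia.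
have [|a [b [c [ab bc ca]]]] := hull_triangle Pinj gp _ E0; first by rewrite cT; lia.
have [ta [ga a12 ra]] := vertex_window Pinj gp kn (Elt _ (leqnn _)) ab ca.
have [tb [gb b12 rb]] := vertex_window Pinj gp kn (Elt _ (leqnn _)) bc ab.
have [tc [gc c12 rc]] := vertex_window Pinj gp kn (Elt _ (leqnn _)) ca bc.
have o : 0 < orient (P a) (P b) (P c).
  move: ab bc ca; rewrite !inE /= => /andP[nab /eqP/cards0_eq/setP/(_ c)].
  rewrite !inE /= => /negbT; rewrite -leNgt => abc /andP[nbc _] /andP[nca _].
  by rewrite lt_neqAle eq_sym gp // eq_sym.
have cab : 0 < cross ta tb := cross_ccw o a12 b12.
have cbc : 0 < cross tb tc by apply: cross_ccw b12 c12; rewrite orient_cycle.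
have cca : 0 < cross tc ta by apply: cross_ccw c12 a12; rewrite -orient_cycle.
have nk : n = (3 * k.+1)%N by rewrite nm mulnC.
have Fa := lowest_opp gp nk ga gb gc cab cbc cca Ek ra rb rc.
have Fb := lowest_opp gp nk gb gc ga cbc cca cab Ek rb rc ra.
have Fc := lowest_opp gp nk gc ga gb cca cab cbc Ek rc ra rb.
have opp_generic d : generic P d -> generic P (opp d).
  by move=> gd i j /gd; rewrite !dot_opp eqr_opp.
pose F d := lowest P setT d k.
have cF d : generic P d -> #|F d| = k.+1 by move=> gd; apply: card_lowest.
have dF d : generic P d -> [disjoint F d & F (opp d)] by move=> gd; apply: lowest_disjoint => //; apply: ltnW.
have dBC : [disjoint F ta & F tb] by rewrite {2}/F Fb; apply: dF.
have dCA : [disjoint F tb & F tc] by rewrite {2}/F Fc; apply: dF.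
have dAB : [disjoint F tc & F ta] by rewrite {2}/F Fa; apply: dF.
have between d i j l : generic P d -> i \in F d -> l \in F (opp d) ->
    j \notin F d -> j \notin F (opp d) -> dot d (P i) < dot d (P j) < dot d (P l).
  move=> gd id ld jd jo; rewrite (lowest_lt id jd) //=.
  by have := lowest_lt ld jo (opp_generic _ gd); rewrite !dot_opp ltrN2.
(* By [Fb], direction [ta] shows [F ta] lowest and [F tb] highest, so [F tc] is in the middle; [Fc]
   and [Fa] give the cyclic shifts. The sides of the triangle follow [ta], [tb], [tc] in this
   order. *)
exists (F tc), (F ta), (F tb); split.
  split=> //; first by rewrite disjoint_sym.
    apply/eqP; rewrite eqEcard subsetT cT cardsU (_ : _ :&: _ = set0) ?cards0 ?subn0.
      by rewrite cardsU (disjoint_setI0 dAB) cards0 subn0 !cF //= nk !mulSn mul0n addn0 addnA.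
    by apply: disjoint_setI0; rewrite disjoints_subset subUset -!disjoints_subset disjoint_sym dCA.
  by rewrite !cF.
have [v0 [v1 [v2 [inT [ka [kb [kc [[p0 p1 p2] [s0 s1 s2]]]]]]]]] := triangle P cab cbc cca.
exists v0, v1, v2; split=> //.
have notin (A B : {set 'I_n}) i : [disjoint A & B] -> i \in A -> i \notin B.
  by move=> dAB' iA; rewrite (disjointFr dAB').
have [dBA dCB dAC] : [/\ [disjoint F ta & F tc], [disjoint F tb & F ta] & [disjoint F tc & F tb]].
  by split; rewrite disjoint_sym.
split; [|split]; left=> x y z xA yB zC.
- rewrite !(proj_coord_lt _ _ s0 p0).
  by apply: between; rewrite // -?[F (opp _)]Fb //; apply: notin xA.
- rewrite !(proj_coord_lt _ _ s1 p1).
  by apply: between; rewrite // -?[F (opp _)]Fc //; apply: notin xA.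
rewrite !(proj_coord_lt _ _ s2 p2).
by apply: between; rewrite // -?[F (opp _)]Fa //; apply: notin xA.
Qed.
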